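(* Let $\lambda_o$ be a fixed operating point. For the linearized system with transfer function $G_p(z)=\dot{s}(\lambda_o)-\dot{w}(\lambda_o)$ and the observation system $H(z)=z^{-1}$, the price stabilization algorithm $$\lambda_k = \lambda_{k-1} - \frac{2\eta}{\dot{s}(\lambda_o) - \dot{w}(\lambda_o)}\, e_{k-1},\qquad \eta \in (0,1),$$ ensures stability of the closed-loop system.
   Context: Real-time pricing model. In each pricing period $k$ a price $\lambda_k$ is announced. The scheduled total supply is $s(\lambda_k)$, where $s$ is a differentiable increasing function with $\dot s(\lambda_o)>0$. The total demand is $d(k,\lambda_k)=b_k+w(\lambda_k)$, where $w$ is a differentiable decreasing function with $\dot w(\lambda_o)<0$ (the price-responsive demand) and $b_k$ (the baseline demand) is an exogenous bounded sequence independent of the price. A dot denotes the first derivative. The generation scheduling error is $e_k=s(\lambda_k)-d(k,\lambda_k)$. Linearized system at the fixed operating point $\lambda_o$: $s$ and $w$ are replaced by $s(\lambda_o)+\dot s(\lambda_o)(\lambda-\lambda_o)$ and $w(\lambda_o)+\dot w(\lambda_o)(\lambda-\lambda_o)$, so that $$e_k=(\dot s(\lambda_o)-\dot w(\lambda_o))\lambda_k+(s_o-w_o-b_k),$$ with $s_o=s(\lambda_o)-\dot s(\lambda_o)\lambda_o$ and $w_o=w(\lambda_o)-\dot w(\lambda_o)\lambda_o$. The price-independent term $s_o-w_o-b_k$ is treated as a bounded disturbance input, and the transfer function from price to error is $G_p(z)=\dot s(\lambda_o)-\dot w(\lambda_o)$. The observation system $H(z)=z^{-1}$ means that the algorithm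 setting $\lambda_k$ uses the error of the previous period. The reference for $e_k$ is $0$. In $z$-transform terms the pricing algorithm has transfer function $G_c(z)=\frac{2\eta}{(\dot s(\lambda_o)-\dot w(\lambda_o))(1-z^{-1})}$, and the closed-loop transfer function is $T_c(z)=\frac{G_c(z)G_p(z)}{1+G_c(z)G_p(z)H(z)}$. Stability means bounded-input bounded-output stability of the closed-loop discrete-time linear time-invariant system; the criterion used is that all poles of the closed-loop transfer function $T_c(z)$ lie strictly inside the unit circle centered at the origin of the $z$-plane. Limits on the allowed price range are not imposed in the linearized system. *)

(* Defs.v *)
From mathcomp Require Export all_boot all_order all_algebra.
From mathcomp Require Export all_classical all_reals all_analysis.
From mathcomp Require Export complex.
From mathcomp Require Import ring.

Set Implicit Arguments.
Unset Strict Implicit.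
Unset Printing Implicit Defensive.

Import Order.TTheory GRing.Theory Num.Theory.
Import numFieldNormedType.Exports.

Local Open Scope ring_scope.
Local Open Scope complex_scope.

Section LinearizedMarket.
Context {R : realType}.
Implicit Types (f s w : R -> R) (lo eta : R).

Definition linearize f lo (x : R) : R := f lo + derive1 f lo * (x - lo).

Definition intercept f lo : R := f lo - derive1 f lo * lo.

(* The demand is the baseline [b] plus the price-responsive part [w]. *)
Definition linearized_error s w lo (b lam : R) : R :=
  linearize s lo lam - (b + linearize w lo lam).

Definition slope_gap s w lo : R := derive1 s lo - derive1 w lo.

Definition disturbance s w lo (b : R) : R :=
  intercept s lo - intercept w lo - b.

Lemma linearized_errorE s w lo b lam :
  linearized_error s w lo b lam =
  slope_gap s w lo * lam + disturbance s w lo b.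
Proof.
rewrite /linearized_error /linearize /slope_gap /disturbance /intercept.
by ring.
Qed.

Definition update_gain s w lo eta : R := 2 * eta / slope_gap s w lo.

(* The reference [r] is the input of the closed-loop transfer function; for
   [r = 0] the update is lam_k = lam_(k-1) - gain * e_(k-1).  The initial
   price [lam 0] is arbitrary. *)
Definition price_update s w lo eta (r e lam : nat -> R) : Prop :=
  forall k, lam k.+1 = lam k - update_gain s w lo eta * (e k - r k.+1).

(* The external inputs of the closed loop are the reference [r] and the
   price-independent disturbance; its output is the scheduling error [e]. *)
Definition closed_loop_bibo_stable s w lo eta : Prop :=
  forall r b lam e : nat -> R,
    (forall k, e k = linearized_error s w lo (b k) (lam k)) ->
    price_update s w lo eta r e lam ->
    bounded_fun r ->
    bounded_fun (fun k => disturbance s w lo (b k)) ->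
    bounded_fun e.

End LinearizedMarket.

Section TransferFunctions.
Context {R : realType}.
Implicit Types (s w : R -> R) (lo eta : R).

Definition cst_tf (c : R) : {fraction {poly R[i]}} := tofrac (c%:C)%:P.

Definition z_tf : {fraction {poly R[i]}} := tofrac 'X.

Definition Gp s w lo : {fraction {poly R[i]}} := cst_tf (slope_gap s w lo).

Definition Hobs : {fraction {poly R[i]}} := z_tf^-1.

Definition Gc s w lo eta : {fraction {poly R[i]}} :=
  cst_tf (2 * eta) / (cst_tf (slope_gap s w lo) * (1 - z_tf^-1)).

Definition Tc s w lo eta : {fraction {poly R[i]}} :=
  Gc s w lo eta * Gp s w lo / (1 + Gc s w lo eta * Gp s w lo * Hobs).

(* The poles are read off a representation in lowest terms: a root of the
   denominator that cancels against the numerator is not a pole. *)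
Definition pole (f : {fraction {poly R[i]}}) (p : R[i]) : Prop :=
  exists n d : {poly R[i]},
    [/\ d != 0, coprimep n d, f = tofrac n / tofrac d & root d p].

End TransferFunctions.

(* Main.v *)
(** In closed loop the error obeys e_(k+1) = (1 - 2 eta) e_k + v_k, where v is
    a combination of the reference and of increments of the disturbance, and
    |1 - 2 eta| < 1.  Correspondingly Tc reduces to
    2 eta z / (z - (1 - 2 eta)), whose only possible pole is 1 - 2 eta. *)
Require Import Defs.
From mathcomp Require Import ring lra.

Set Implicit Arguments.
Unset Strict Implicit.
Unset Printing Implicit Defensive.

Import Order.TTheory GRing.Theory Num.Theory.
Import numFieldNormedType.Exports.
Local Open Scope ring_scope.

Lemma bounded_funP (R : realType) (u : nat -> R) :
  bounded_fun u <-> exists M : R, forall k, `|u k| <= M.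
Proof.
split=> [bu|[M uM]].
  by have [M _ uM] := ex_strict_bound_gt0 bu; exists M => k; exact/ltW/uM.
by exists M; split; [exact: num_real|move=> x Mx k _; exact/(le_trans (uM k))/ltW].
Qed.

Lemma affine_recurrence_bounded (R : realType) (a : R) (x v : nat -> R) :
  `|a| < 1 -> (forall k, x k.+1 = a * x k + v k) ->
  bounded_fun v -> bounded_fun x.
Proof.
move=> a1 xS /bounded_funP[V vV]; apply/bounded_funP.
have V0 : 0 <= V by exact: le_trans (vV 0%N).
have a1' : 0 < 1 - `|a| by rewrite subr_gt0.
(* V / (1 - |a|) is the fixed point of M |-> |a| M + V. *)
exists (`|x 0%N| + V / (1 - `|a|)) => k.
have Q0 : 0 <= V / (1 - `|a|) by rewrite divr_ge0// ltW.
elim: k => [|k IH]; first by rewrite lerDl.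
rewrite xS (le_trans (ler_normD _ _))// normrM.
have QE : V = (1 - `|a|) * (V / (1 - `|a|)).
  by rewrite mulrCA divff ?mulr1// gt_eqF.
(* With Q the quotient above, [|a| (|x 0| + Q)] and [(1 - |a|) Q] sum to at most [|x 0| + Q], since
   the [|a| Q] terms cancel. *)
have := ler_wpM2l (normr_ge0 a) IH.
have := ler_piMl (normr_ge0 (x 0%N)) (ltW a1).
have := vV k; rewrite [X in _ <= X -> _]QE.
by set Q := V / _; lra.
Qed.

(** The error is affine in the price with slope [slope_gap], and the gain divides by that slope, so
    only [2 * eta] survives. *)
Lemma closed_loop_error (R : realType) (s w : R -> R) (lo eta : R)
    (r b lam e : nat -> R) :
  slope_gap s w lo != 0 ->
  (forall k, e k = linearized_error s w lo (b k) (lam k)) ->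
  price_update s w lo eta r e lam ->
  forall k, e k.+1 = (1 - 2 * eta) * e k +
    (disturbance s w lo (b k.+1) - disturbance s w lo (b k)
     + 2 * eta * r k.+1).
Proof.
move=> g0 eE lamS k.
rewrite [LHS]eE linearized_errorE lamS /update_gain.
have gE : slope_gap s w lo * lam k = e k - disturbance s w lo (b k).
  by rewrite eE linearized_errorE addrK.
rewrite mulrBr gE; field.
exact: g0.
Qed.

Lemma closed_loop_stable (R : realType) (s w : R -> R) (lo eta : R) :
  slope_gap s w lo != 0 -> `|1 - 2 * eta| < 1 ->
  closed_loop_bibo_stable s w lo eta.
Proof.
move=> g0 c1 r b lam e eE lamS /bounded_funP[M rM] /bounded_funP[D dD].
apply: (affine_recurrence_bounded c1 (closed_loop_error g0 eE lamS)).
(* [D + D] bounds the increment of the disturbance, the last term the scaled reference. *)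
apply/bounded_funP; exists (D + D + `|2 * eta| * M) => k.
apply: le_trans (ler_normD _ _) _; rewrite normrM lerD ?ler_wpM2l//.
by apply: le_trans (ler_normB _ _) _; rewrite lerD.
Qed.

(* Over an abstract field because [field] diverges on {fraction {poly R[i]}}. *)
Lemma delayed_feedback (F : fieldType) (c g z : F) :
  g != 0 -> z != 0 -> z - 1 != 0 -> z - 1 + c != 0 ->
  c / (g * (1 - z^-1)) * g / (1 + c / (g * (1 - z^-1)) * g * z^-1) =
  c * z / (z - 1 + c).
Proof. by move=> g0 z0 z1 d0; field; rewrite d0 z1 z0 g0. Qed.

(** The gap and the integrator factor [z - 1] cancel. The quotient need not be in lowest terms: at
    [eta = 1/2] it is ['X / 'X]. *)
Lemma Tc_reduced (R : realType) (s w : R -> R) (lo eta : R) :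
  slope_gap s w lo != 0 ->
  Tc s w lo eta = tofrac ((2 * eta)%:C%:P * 'X)%C /
                  tofrac ('X - (1 - 2 * eta)%:C%:P)%C.
Proof.
move=> g0; rewrite /Tc /Gc /Gp /Hobs.
have X1 (c : R[i]) : tofrac ('X - c%:P) != 0 by rewrite tofrac_eq0 polyXsubC_eq0.
have z0 : z_tf (R := R) != 0 by rewrite tofrac_eq0 polyX_eq0.
have z1 : z_tf - 1 != 0 :> {fraction {poly R[i]}}.
  by have := X1 1; rewrite rmorphB/= polyC1 tofrac1.
have G0 : cst_tf (slope_gap s w lo) != 0.
  by rewrite tofrac_eq0 polyC_eq0 (fmorph_eq0 (real_complex R)).
have dE : tofrac ('X - (1 - 2 * eta)%:C%:P)%C = z_tf - 1 + cst_tf (2 * eta).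
  rewrite -tofrac1 -tofracB -tofracD; congr tofrac.
  by rewrite rmorphB rmorph1 /= polyCB polyC1 opprB addrA addrAC.
have d0 := X1 (1 - 2 * eta)%:C%C.
rewrite dE rmorphM/= -/z_tf -/(cst_tf _); rewrite dE in d0.
(* Without this generalization, unification unfolds the concrete fractions. *)
move: (cst_tf (2 * eta)) (cst_tf (slope_gap s w lo)) z_tf G0 z0 z1 d0 => c g z.
exact: delayed_feedback.
Qed.

(** Since [m] may vanish at [c], a coprime pair [n], [d] is compared with it: [m * d = n * ('X - c)]
    at the root [p] of [d] gives n(p)(p - c) = 0, and coprimality excludes n(p) = 0. *)
Lemma pole_divXsubC (R : realType) (m : {poly R[i]}) (c p : R[i]) :
  pole (tofrac m / tofrac ('X - c%:P)) p -> p = c.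
Proof.
move=> [n [d [d0 nd /eqP + dp]]].
rewrite eqr_div ?tofrac_eq0 ?polyXsubC_eq0// -!tofracM tofrac_eq => /eqP mdE.
have /eqP := congr1 (horner^~ p) mdE.
rewrite !hornerM (rootP dp) mulr0 hornerXsubC eq_sym mulf_eq0 subr_eq0.
case/orP=> [np|/eqP//].
by have := coprimep_root nd np; rewrite (rootP dp) eqxx.
Qed.

Theorem proposition1 (R : realType) (s w : R -> R) (lo eta : R)
  (s_derivable : forall x : R, derivable s x 1)
  (w_derivable : forall x : R, derivable w x 1)
  (s_increasing : {homo s : x y / x <= y})
  (w_decreasing : {homo w : x y /~ x <= y})
  (s_slope : 0 < derive1 s lo)
  (w_slope : derive1 w lo < 0)
  (eta_gt0 : 0 < eta) (eta_lt1 : eta < 1) :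
  closed_loop_bibo_stable s w lo eta /\
  (forall p : R[i], pole (Tc s w lo eta) p -> `|p| < 1).
Proof.
have g0 : slope_gap s w lo != 0.
  by rewrite gt_eqF// /slope_gap subr_gt0 (lt_trans w_slope).
(* The interval [0 < eta < 1] is exactly this contraction condition. *)
have c1 : `|1 - 2 * eta| < 1 by rewrite ltr_norml; apply/andP; split; lra.
split=> [|p]; first exact: closed_loop_stable.
rewrite Tc_reduced// => /pole_divXsubC ->.
(* The pole is real, so its complex modulus is [|1 - 2 * eta|]. *)
by rewrite normc_def/= expr0n/= addr0 sqrtr_sqr ltcR.
Qed.
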